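(* Let $m\ge r\ge0$ be integers and let $(\varphi_1,\ldots,\varphi_m)$ be a partition of $r$, i.e. a tuple of non-negative integers with $\sum_{i=1}^m i\,\varphi_i=r$. Then $$\sum_{\substack{\sum i y_i=m\\ \sum y_i\text{ even}}}\prod_{i=1}^{m}\frac{\binom{y_i}{\varphi_i}}{i^{y_i}\,y_i!}=\sum_{\substack{\sum i y_i=m\\ \sum y_i\text{ even}\\ y_i\ge\varphi_i\ \forall i}}\prod_{i=1}^{m}\frac{\binom{y_i}{\varphi_i}}{i^{y_i}\,y_i!}=\begin{cases}\frac{1+(-1)^{\sum\varphi_i}}{2}\prod_{i=1}^{m}\frac{1}{i^{\varphi_i}\varphi_i!} & \text{for } m-r=0,\\[2pt] \frac{1-(-1)^{\sum\varphi_i}}{2}\prod_{i=1}^{m}\frac{1}{i^{\varphi_i}\varphi_i!} & \text{for } m-r=1,\\[2pt] \frac12\prod_{i=1}^{m}\frac{1}{i^{\varphi_i}\varphi_i!} & \text{for } m-r\ge2,\end{cases}$$ and $$\sum_{\substack{\sum i y_i=m\\ \sum y_i\text{ odd}}}\prod_{i=1}^{m}\frac{\binom{y_i}{\varphi_i}}{i^{y_i}\,y_i!}=\sum_{\substack{\sum i y_i=m\\ \sum y_i\text{ odd}\\ y_i\ge\varphi_i\ \forall i}}\prod_{i=1}^{m}\frac{\binom{y_i}{\varphi_i}}{i^{y_i}\,y_i!}=\begin{cases}\frac{1-(-1)^{\sum\varphi_i}}{2}\prod_{i=1}^{m}\frac{1}{i^{\varphi_i}\varphi_i!} & \text{for }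 m-r=0,\\[2pt] \frac{1+(-1)^{\sum\varphi_i}}{2}\prod_{i=1}^{m}\frac{1}{i^{\varphi_i}\varphi_i!} & \text{for } m-r=1,\\[2pt] \frac12\prod_{i=1}^{m}\frac{1}{i^{\varphi_i}\varphi_i!} & \text{for } m-r\ge2,\end{cases}$$ where the sums run over the partitions $(y_1,\ldots,y_m)$ of $m$ satisfying the indicated conditions.
   Context: A partition of $m$ is represented by the tuple $(y_1,\ldots,y_m)$ of non-negative integers with $\sum_{i=1}^m i\,y_i=m$. Write $\sum y_i=\sum_{i=1}^m y_i$ and $\sum\varphi_i=\sum_{i=1}^m\varphi_i$. For $m=0$ there is exactly one partition, the empty one. Empty products equal $1$, empty sums equal $0$, and $\binom{a}{b}=0$ for integers $0\le a<b$. *)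

(* Defs.v *)
From mathcomp Require Import all_boot all_order all_algebra.
Set Implicit Arguments.
Unset Strict Implicit.
Unset Printing Implicit Defensive.
Import GRing.Theory.
Local Open Scope ring_scope.

(* Ordinals start at 0: the entry y i, for i : 'I_m, is the multiplicity of
   the part i.+1. The length m of the tuple and the partitioned integer n are
   separate, since phi has length m but is a partition of r <= m. *)
Definition is_partition (m n : nat) (y : 'I_m -> nat) : bool :=
  (\sum_(i < m) i.+1 * y i == n)%N.

Definition num_parts (m : nat) (y : 'I_m -> nat) : nat := (\sum_(i < m) y i)%N.

(* By this bound, the sums over all partitions of m can range over the finite
   type {ffun 'I_m -> 'I_m.+1}. *)
Lemma is_partition_le (m n : nat) (y : 'I_m -> nat) (i : 'I_m) :
  is_partition n y -> (y i <= n)%N.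
Proof.
move=> /eqP <-; rewrite (bigD1 i) //=.
by apply: leq_trans (leq_addr _ _); rewrite leq_pmull.
Qed.

Definition mults (m : nat) (y : {ffun 'I_m -> 'I_m.+1}) : 'I_m -> nat :=
  fun i => y i.

Definition summand (m : nat) (phi y : 'I_m -> nat) : rat :=
  \prod_(i < m) ('C(y i, phi i)%:R / (i.+1%:R ^+ y i * (y i)`!%:R)).

Definition phi_weight (m : nat) (phi : 'I_m -> nat) : rat :=
  \prod_(i < m) (1 / (i.+1%:R ^+ phi i * (phi i)`!%:R)).

(* Main.v *)
Require Import Defs.
From mathcomp Require Import all_boot all_order all_algebra.
From mathcomp Require Import ring zify.
Set Implicit Arguments.
Unset Strict Implicit.
Unset Printing Implicit Defensive.
Import GRing.Theory.
Local Open Scope ring_scope.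

(** Why the theorem holds. Mark the number of parts of a partition by a
    variable x and the partitioned integer by 'X. The weighted sum
      S(x) = \sum_y x ^+ (\sum_i y_i) \prod_i 'C(y_i, phi_i) / (i^y_i y_i!)
    over the partitions y of m is the coefficient of 'X^m in a product over i of
    one series per part size. Since
      'C(y, phi) / (i^y y!) = 1 / (i^phi phi!) * 1 / (i^(y - phi) (y - phi)!),
    the i-th series is x^phi_i 'X^(i phi_i) / (i^phi_i phi_i!) times the
    exponential of x 'X^i / i. The monomial factors multiply to
    x^(\sum phi_i) 'X^r phi_weight phi, and the exponentials to
    exp (x \sum_i 'X^i / i) = (1 - 'X)^(-x), so S(x) is
    x^(\sum phi_i) phi_weight phi times the coefficient of 'X^(m - r) in
    (1 - 'X)^(-x) (weighted_partition_sum). At x = 1 this series is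
    1 + 'X + 'X^2 + ..., and at x = -1 it is 1 - 'X; the three cases
    m - r = 0, m - r = 1 and m - r >= 2 are the coefficients 1, -1 and 0 of the
    latter. The sums over even and odd numbers of parts are
    (S(1) + S(-1)) / 2 and (S(1) - S(-1)) / 2 (parity_sum).

    Polynomials replace the power series: each exponential is truncated, and
    the identity with (1 - 'X)^(-x) is kept in the form of the differential
    equation (1 - 'X) G' = x G modulo a power of 'X, which determines the low
    coefficients of G by a recurrence (prod_exp_monomial_ode and
    coef_prod_exp_monomial). *)

(** The exponential series of x 'X^(i.+1) / i.+1, truncated after N.+1 terms. *)
Definition exp_monomial (F : numFieldType) (x : F) (i N : nat) : {poly F} :=
  \sum_(j < N.+1) (x ^+ j / (i.+1%:R ^+ j * j`!%:R)) *: 'X^(i.+1 * j).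

(** The exponential series solves E' = x 'X^i E; truncation leaves as error only
    the contribution of the last term of the sum. *)
Lemma deriv_exp_monomial (F : numFieldType) (x : F) (i N : nat) :
  (exp_monomial x i N)^`() - x *: 'X^i * exp_monomial x i N =
  - (x ^+ N.+1 / (i.+1%:R ^+ N * N`!%:R)) *: 'X^(i.+1 * N + i).
Proof.
have nz n : n.+1%:R != 0 :> F by rewrite Num.Theory.pnatr_eq0.
rewrite /exp_monomial; elim: N => [|N IH].
  rewrite big_ord_recl big_ord0 /= muln0 !expr0 fact0 !mul1r invr1 scale1r addr0.
  by rewrite !mulr1 -polyC1 derivC add0r add0n scaleNr.
rewrite big_ord_recr /= derivD mulrDr opprD addrACA {}IH derivZ derivXn.
have -> : (i.+1 * N.+1).-1 = (i.+1 * N + i)%N by lia.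
rewrite -scalerAl -scalerAr -exprD scalerA -scaler_nat scalerA addrA -scalerDl.
have -> : - (x ^+ N.+1 / (i.+1%:R ^+ N * N`!%:R))
    + x ^+ N.+1 / (i.+1%:R ^+ N.+1 * (N.+1)`!%:R) * (i.+1 * N.+1)%:R = 0.
  rewrite factS !natrM [i.+1%:R ^+ N.+1]exprS.
  have h1 : N`!%:R != 0 :> F by rewrite Num.Theory.pnatr_eq0 -lt0n fact_gt0.
  have h2 : i.+1%:R ^+ N != 0 :> F by rewrite expf_neq0.
  by field; rewrite !nat1r h1 h2 !nz.
by rewrite scale0r add0r -scaleNr mulrA -exprS addnC.
Qed.

(** The logarithmic derivatives x 'X^i of the factors add up to
    x (1 - 'X^m) / (1 - 'X), so the product approximates (1 - 'X)^(-x). The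
    bound on N i says that the truncation error of the i-th factor starts in
    degree at least K, and K <= m that the missing part sizes above m have no
    influence below that degree. *)
Lemma prod_exp_monomial_ode (F : numFieldType) (x : F) (m K : nat)
    (N : 'I_m -> nat) :
  (K <= m)%N -> (forall i : 'I_m, K < i.+1 * (N i).+1)%N ->
  'X^K %| (1 - 'X) * (\prod_(i < m) exp_monomial x i (N i))^`()
            - x *: \prod_(i < m) exp_monomial x i (N i).
Proof.
move=> Km hN; set G := \prod_(i < m) _.
(* Leibniz rule: logarithmic derivatives add, and so do the errors. *)
have logD : 'X^K %| G^`() - (\sum_(i < m) x *: 'X^i) * G.
  rewrite /G; elim/big_rec2: _ => [|i p D _ IH].
    by rewrite -polyC1 derivC mul0r subr0 dvdp0.
  rewrite derivM; set e := exp_monomial _ _ _.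
  have -> : e^`() * D + e * D^`() - (x *: 'X^i + p) * (e * D) =
    (e^`() - x *: 'X^i * e) * D + e * (D^`() - p * D) by ring.
  apply: dvdp_add; last exact: dvdp_mull.
  rewrite deriv_exp_monomial -scalerAl -mul_polyC; apply: dvdp_mull.
  by apply: dvdp_mulr; apply: dvdp_exp2l; have := hN i; lia.
have geom : (1 - 'X) * (\sum_(i < m) x *: 'X^i) = x *: (1 - 'X^m) :> {poly F}.
  by rewrite -scaler_sumr -scalerAr -opprB mulNr -subrX1 opprB.
have -> : (1 - 'X) * G^`() - x *: G =
    (1 - 'X) * (G^`() - (\sum_(i < m) x *: 'X^i) * G) - 'X^m * (x *: G).
  by rewrite mulrBr mulrA geom -!mul_polyC; ring.
apply: dvdp_sub; first exact: dvdp_mull.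
by apply: dvdp_mulr; apply: dvdp_exp2l.
Qed.

(** These are the coefficients of (1 - 'X)^(-x): comparing coefficients of 'X^k
    in the differential equation gives (k + 1) G_(k+1) = (k + x) G_k. *)
Lemma coef_prod_exp_monomial (F : numFieldType) (x : F) (m K : nat)
    (N : 'I_m -> nat) (k : nat) :
  (K <= m)%N -> (forall i : 'I_m, K < i.+1 * (N i).+1)%N -> (k <= K)%N ->
  (\prod_(i < m) exp_monomial x i (N i))`_k =
  \prod_(j < k) ((x + j%:R) / j.+1%:R).
Proof.
move=> Km hN; have := prod_exp_monomial_ode x Km hN; set G := \prod_(i < m) _.
move=> /dvdpP [q ode]; elim: k => [_|k IH kK].
  rewrite big_ord0 -horner_coef0 horner_prod big1 // => i _.
  rewrite /exp_monomial horner_sum big_ord_recl big1 => [|j _].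
    by rewrite hornerZ muln0 !expr0 hornerC fact0 !mul1r invr1 !mulr1 addr0.
  by rewrite hornerZ hornerXn mulnS expr0n mulr0.
have := congr1 (coefp k) ode; rewrite /coefp coefMXn kK.
rewrite coefB mulrBl mul1r coefB coefXM coefZ !coef_deriv.
have -> : (if k == 0%N then 0 else G`_k.-1.+1 *+ k.-1.+1) = G`_k *+ k.
  by case: (k).
rewrite big_ord_recr /= -{}IH; last exact: ltnW.
rewrite -[_ *+ k.+1]mulr_natr -[G`_k *+ k]mulr_natr.
have nz : k.+1%:R != 0 :> F by rewrite Num.Theory.pnatr_eq0.
move=> h; apply: (mulIf nz).
transitivity (x * G`_k + G`_k * k%:R).
  by apply/eqP; rewrite -subr_eq0 opprD [- (x * _) + _]addrC addrA h.
by rewrite -mulrA divfK // mulrDr mulrC.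
Qed.

(** Generating series of one part size: the terms with j < a vanish, and
    'C(j, a) / j! = 1 / (a! (j - a)!) splits off a monomial from the rest. *)
Lemma binomial_exp_monomial (F : numFieldType) (x : F) (i a n : nat) :
  (a <= n)%N ->
  \sum_(j < n.+1)
     (x ^+ j * ('C(j, a)%:R / (i.+1%:R ^+ j * j`!%:R))) *: 'X^(i.+1 * j) =
  (x ^+ a * (1 / (i.+1%:R ^+ a * a`!%:R))) *: 'X^(i.+1 * a)
    * exp_monomial x i (n - a) :> {poly F}.
Proof.
move=> le_an; rewrite -[in LHS](subnKC le_an); move: (n - a)%N => {n le_an}n.
rewrite -addnS big_split_ord /= big1 ?add0r => [|j _]; last first.
  by rewrite bin_small // mul0r mulr0 scale0r.
rewrite /exp_monomial mulr_sumr; apply: eq_bigr => j _.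
rewrite -scalerAl -scalerAr -exprD scalerA -mulnDr; congr (_ *: _).
have nzf k : k`!%:R != 0 :> F by rewrite Num.Theory.pnatr_eq0 -lt0n fact_gt0.
have nzi k : i.+1%:R ^+ k != 0 :> F by rewrite expf_neq0 ?Num.Theory.pnatr_eq0.
have <- : 'C(a + j, a)%:R * (a`!%:R * j`!%:R) = (a + j)`!%:R :> F.
  by rewrite -!natrM -[in RHS](bin_fact (leq_addr j a)) addKn.
have nzb : 'C(a + j, a)%:R != 0 :> F.
  by rewrite Num.Theory.pnatr_eq0 -lt0n bin_gt0 leq_addr.
rewrite !exprD; field.
by rewrite nzb !nzf !nzi.
Qed.

Lemma coef_prod_partitions (F : numFieldType) (m n N : nat)
    (c : 'I_m -> nat -> F) :
  (\prod_(i < m) \sum_(j < N) c i j *: 'X^(i.+1 * j))`_n =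
  \sum_(y : {ffun 'I_m -> 'I_N} | is_partition n (fun i => y i))
     \prod_(i < m) c i (y i).
Proof.
rewrite bigA_distr_bigA /= coef_sum [RHS]big_mkcond /=; apply: eq_bigr => y _.
have -> : \prod_(i < m) (c i (y i) *: 'X^(i.+1 * y i)) =
    (\prod_(i < m) c i (y i)) *: 'X^(\sum_(i < m) i.+1 * y i) :> {poly F}.
  rewrite -mul_polyC rmorph_prod -prodrXr -big_split /=.
  by apply: eq_bigr => i _; rewrite mul_polyC.
rewrite coefZ coefXn /is_partition eq_sym.
by case: eqP; rewrite ?mulr1 ?mulr0.
Qed.

(** Both parities at once: the variable x keeps track of the number of parts. *)
Lemma weighted_partition_sum (m r : nat) (phi : 'I_m -> nat) (x : rat) :
  (r <= m)%N -> is_partition r phi ->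
  \sum_(y : {ffun 'I_m -> 'I_m.+1} | is_partition m (mults y))
     x ^+ num_parts (mults y) * summand phi (mults y) =
  x ^+ num_parts phi * phi_weight phi
    * \prod_(j < m - r) ((x + j%:R) / j.+1%:R).
Proof.
move=> rm hphi.
have part_le (i : 'I_m) : (i.+1 * phi i <= r)%N.
  by move/eqP: hphi => <-; rewrite (bigD1 i) //= leq_addr.
have phi_le (i : 'I_m) : (phi i <= m)%N.
  exact: leq_trans (is_partition_le i hphi) rm.
pose c (i : 'I_m) (j : nat) : rat :=
  x ^+ j * ('C(j, phi i)%:R / (i.+1%:R ^+ j * j`!%:R)).
transitivity (\prod_(i < m) \sum_(j < m.+1) c i j *: 'X^(i.+1 * j))`_m.
  rewrite coef_prod_partitions; apply: eq_bigr => y _.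
  by rewrite big_split /= prodrXr.
have -> : \prod_(i < m) \sum_(j < m.+1) c i j *: 'X^(i.+1 * j) =
    (x ^+ num_parts phi * phi_weight phi) *: 'X^r
    * \prod_(i < m) exp_monomial x i (m - phi i).
  transitivity (\prod_(i < m)
      (((x ^+ phi i * (1 / (i.+1%:R ^+ phi i * (phi i)`!%:R)))%:P
       * 'X^(i.+1 * phi i)) * exp_monomial x i (m - phi i))).
    by apply: eq_bigr => i _; rewrite mul_polyC -binomial_exp_monomial.
  rewrite !big_split /= -rmorph_prod big_split /= !prodrXr.
  by move/eqP: hphi => ->; rewrite mul_polyC.
rewrite -scalerAl coefZ coefXnM ltnNge rm /=; congr (_ * _).
apply: (@coef_prod_exp_monomial _ _ _ (m - r)) => //; first exact: leq_subr.
(* The first omitted term of the i-th exponential has degree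
   i.+1 * (m - phi i).+1, which exceeds m - r because i.+1 * phi i <= r. *)
by move=> i; have := part_le i; have := phi_le i; nia.
Qed.

Lemma prod_shift1_ratio (k : nat) :
  \prod_(j < k) ((1 + j%:R) / j.+1%:R) = 1 :> rat.
Proof.
by apply: big1 => j _; rewrite -natr1 addrC divff // natr1 Num.Theory.pnatr_eq0.
Qed.

Lemma prod_shiftN1_ratio (k : nat) :
  \prod_(j < k) ((-1 + j%:R) / j.+1%:R) =
  (if k == 0%N then 1 else if k == 1%N then -1 else 0) :> rat.
Proof.
case: k => [|[|k]]; first by rewrite big_ord0.
  by rewrite big_ord_recl big_ord0 addr0 invr1 !mulr1.
by rewrite !big_ord_recl /= addNr !mul0r mulr0.
Qed.

(** The indicator of parity b is (1 + (-1)^(b + number of parts)) / 2, so the sum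
    is the half sum, up to the sign (-1)^b, of the weighted sums at 1 and -1. *)
Lemma parity_sum (m r : nat) (phi : 'I_m -> nat) (b : bool) :
  (r <= m)%N -> is_partition r phi ->
  \sum_(y : {ffun 'I_m -> 'I_m.+1} |
        is_partition m (mults y) && (odd (num_parts (mults y)) == b))
     summand phi (mults y) =
  (1 + (-1) ^+ (b + num_parts phi)
       * (if (m - r == 0)%N then 1 else if (m - r == 1)%N then -1 else 0))
    / 2%:R * phi_weight phi.
Proof.
move=> rm hphi.
have := weighted_partition_sum 1 rm hphi.
have := weighted_partition_sum (-1) rm hphi.
rewrite prod_shift1_ratio prod_shiftN1_ratio expr1n mul1r mulr1.
set e := if _ then _ else _.
move=> hm hp.
have -> : (1 + (-1) ^+ (b + num_parts phi) * e) / 2%:R * phi_weight phi =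
    (phi_weight phi
     + (-1) ^+ b * ((-1) ^+ num_parts phi * phi_weight phi * e)) / 2%:R.
  by rewrite exprD; ring.
rewrite -[in RHS]hm -[X in X + _]hp mulr_sumr -big_split mulr_suml.
rewrite [LHS]big_mkcondr; apply: eq_bigr => y _ /=.
rewrite expr1n -[(-1) ^+ num_parts (mults y)]signr_odd.
by case: (odd _) b {e hm hp} => -[] /=; rewrite ?expr0 ?expr1; field.
Qed.

Lemma summand_restrict (m : nat) (phi : 'I_m -> nat)
    (P : pred {ffun 'I_m -> 'I_m.+1}) :
  \sum_(y | P y && [forall i, phi i <= mults y i]%N) summand phi (mults y) =
  \sum_(y | P y) summand phi (mults y).
Proof.
rewrite [LHS]big_mkcondr; apply: eq_bigr => y _; case: ifPn => //.
rewrite negb_forall => /existsP [i]; rewrite -ltnNge => lt_i.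
by rewrite /summand (bigD1 i) //= bin_small // !mul0r.
Qed.

Theorem theorem6p3 (m r : nat) (phi : 'I_m -> nat)
    (hr : (r <= m)%N) (hphi : is_partition r phi) :
  [/\ \sum_(y : {ffun 'I_m -> 'I_m.+1} |
            is_partition m (mults y) && ~~ odd (num_parts (mults y)))
         summand phi (mults y)
      = \sum_(y : {ffun 'I_m -> 'I_m.+1} |
            [&& is_partition m (mults y), ~~ odd (num_parts (mults y))
              & [forall i, phi i <= mults y i]%N])
         summand phi (mults y),
      \sum_(y : {ffun 'I_m -> 'I_m.+1} |
            [&& is_partition m (mults y), ~~ odd (num_parts (mults y))
              & [forall i, phi i <= mults y i]%N])
         summand phi (mults y)
      = (if (m - r == 0)%N then (1 + (-1) ^+ num_parts phi) / 2%:R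
         else if (m - r == 1)%N then (1 - (-1) ^+ num_parts phi) / 2%:R
         else 1 / 2%:R) * phi_weight phi,
      \sum_(y : {ffun 'I_m -> 'I_m.+1} |
            is_partition m (mults y) && odd (num_parts (mults y)))
         summand phi (mults y)
      = \sum_(y : {ffun 'I_m -> 'I_m.+1} |
            [&& is_partition m (mults y), odd (num_parts (mults y))
              & [forall i, phi i <= mults y i]%N])
         summand phi (mults y)
    & \sum_(y : {ffun 'I_m -> 'I_m.+1} |
            [&& is_partition m (mults y), odd (num_parts (mults y))
              & [forall i, phi i <= mults y i]%N])
         summand phi (mults y)
      = (if (m - r == 0)%N then (1 - (-1) ^+ num_parts phi) / 2%:R
         else if (m - r == 1)%N then (1 + (-1) ^+ num_parts phi) / 2%:R
         else 1 / 2%:R) * phi_weight phi ].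
Proof.
split.
- by under [RHS]eq_bigl do rewrite andbA; rewrite summand_restrict.
- under eq_bigl do rewrite andbA; rewrite summand_restrict.
  under eq_bigl do rewrite -eqbF_neg; rewrite (parity_sum _ hr hphi).
  by congr (_ * _); case: ifP => _; [|case: ifP => _];
    rewrite ?mulr1 ?mulrN1 ?mulr0 ?addr0.
- by under [RHS]eq_bigl do rewrite andbA; rewrite summand_restrict.
under eq_bigl do rewrite andbA; rewrite summand_restrict.
under eq_bigl do rewrite -[odd _]eqb_id; rewrite (parity_sum _ hr hphi).
by congr (_ * _); case: ifP => _; [|case: ifP => _];
  rewrite ?mulr1 ?mulrN1 ?mulr0 ?addr0 // exprS mulN1r ?opprK.
Qed.
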